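(* (Mean-field LQ control.) Let $K\in\mathbb{N}$ and consider the mean-field stochastic system, for $k\in N_K=\{0,1,\dots,K\}$, $$\begin{cases}\bar x(k+1)=A_1(k)\bar x(k)+\tilde A_1(k)\mathbf{E}\bar x(k)+F_1(k)\bar u(k)+[B_1(k)\bar x(k)+\tilde B_1(k)\mathbf{E}\bar x(k)]\omega(k),\\ \bar z(k)=\begin{bmatrix}\Phi_1(k)\bar x(k)\\ \Psi_1(k)\bar u(k)\end{bmatrix},\qquad \Psi_1(k)^T\Psi_1(k)=I,\qquad \bar x(0)=\bar x_0,\end{cases}$$ with control $\bar u\in l^2_\omega(N_K,\mathbb{R}^q)$ and cost $J^K(\bar x_0,\bar u)=\sum_{k=0}^K\mathbf{E}\|\bar z(k)\|^2$. Suppose that the backward difference equation, for $k\in N_K$, $$\begin{cases}\tilde P_1(k)=L_1(\tilde P_1(k+1))-G_1(\tilde P_1(k+1))H_1(\tilde P_1(k+1))^{-1}G_1(\tilde P_1(k+1))^T,\\ \tilde Q_1(k)=\tilde L_1(\tilde P_1(k+1),\tilde Q_1(k+1))\\ \qquad-\tilde G_1(\tilde P_1(k+1),\tilde Q_1(k+1))\tilde H_1(\tilde P_1(k+1),\tilde Q_1(k+1))^{-1}\tilde G_1(\tilde P_1(k+1),\tilde Q_1(k+1))^T,\\ \tilde P_1(K+1)=\tilde Q_1(K+1)=0,\\ H_1(\tilde P_1(k+1))>0,\quad \tilde H_1(\tilde P_1(k+1),\tilde Q_1(k+1))>0\end{cases}$$ has a unique solution $(\tilde P_1(k),\tilde Q_1(k))$,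 $k\in N_K$. Then there exists $\bar u^*\in l^2_\omega(N_K,\mathbb{R}^q)$ such that $$\min_{\bar u\in l^2_\omega(N_K,\mathbb{R}^q)}J^K(\bar x_0,\bar u)=J^K(\bar x_0,\bar u^* )=[\mathbf{E}\bar x_0]^T\tilde Q_1(0)[\mathbf{E}\bar x_0]\ge0,$$ and $\tilde Q_1(k)\ge0$ for $k\in N_K$, where $$\begin{aligned}\bar u^*(k)=&-H_1(\tilde P_1(k+1))^{-1}G_1(\tilde P_1(k+1))^T\bar x(k)+\big[H_1(\tilde P_1(k+1))^{-1}G_1(\tilde P_1(k+1))^T\\&-\tilde H_1(\tilde P_1(k+1),\tilde Q_1(k+1))^{-1}\tilde G_1(\tilde P_1(k+1),\tilde Q_1(k+1))^T\big]\mathbf{E}\bar x(k).\end{aligned}$$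
   Context: Setting: $\bar x(k)\in\mathbb{R}^n$ is the state, $\bar u(k)\in\mathbb{R}^q$ the control. For each $k\in N_K$, $A_1(k),\tilde A_1(k),B_1(k),\tilde B_1(k)\in\mathbb{R}^{n\times n}$, $F_1(k)\in\mathbb{R}^{n\times q}$, and $\Phi_1(k)$ (with $n$ columns), $\Psi_1(k)$ (with $q$ columns) are given deterministic real matrices. The initial value $\bar x_0\in\mathbb{R}^n$ is deterministic. $\mathbf{E}$ denotes expectation. $\{\omega(k)\}_{k\in N_K}$ are real random variables on a complete probability space $(\Omega,\mathcal{F},\mu)$ with $\mathbf{E}\omega(s)=0$ and $\mathbf{E}[\omega(s)\omega(t)]=\delta_{st}$. Let $\mathcal{F}_k=\sigma(\omega(0),\dots,\omega(k))$, with $\mathcal{F}_{-1}$ trivial; $\omega(k)$ is independent of $\mathcal{F}_{k-1}$ for every $k$. $l^2_\omega(N_K,\mathbb{R}^p)$ is the space of finite sequences $(y(k))_{k\in N_K}$ of square-integrable $\mathbb{R}^p$-valued random vectors with $y(k)$ being $\mathcal{F}_{k-1}$-measurable. Notation: $\mathbb{A}_1=A_1+\tilde A_1$, $\mathbb{B}_1=B_1+\tilde B_1$ (at time $k$). Writing $P=\tilde P_1(k+1)$, $Q=\tilde Q_1(k+1)$ and evaluating all coefficients at time $k$: $L_1(P)=A_1^TPA_1+B_1^TPB_1+\Phi_1^T\Phi_1$, $G_1(P)=A_1^TPF_1$, $H_1(P)=I_q+F_1^TPF_1$, $\tilde L_1(P,Q)=\mathbb{A}_1^TQ\mathbb{A}_1+\mathbb{B}_1^TP\mathbb{B}_1+\Phi_1^T\Phi_1$,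 $\tilde G_1(P,Q)=\mathbb{A}_1^TQF_1$, $\tilde H_1(P,Q)=I_q+F_1^TQF_1$. The unknowns $\tilde P_1(k),\tilde Q_1(k)$ are real symmetric $n\times n$ matrices; $X>0$ ($X\ge0$) means positive definite (semidefinite). In the formula for $\bar u^*$, $\bar x$ is the state of the system in closed loop with $\bar u^*$. *)

(* Defs.v *)
From HB Require Import structures.
From mathcomp Require Import all_boot all_order all_algebra.
From mathcomp Require Import all_classical all_reals all_analysis.

Set Implicit Arguments.
Unset Strict Implicit.
Unset Printing Implicit Defensive.

Import Order.TTheory GRing.Theory Num.Theory.

Local Open Scope classical_set_scope.
Local Open Scope ring_scope.

Definition qform (R : realType) (n : nat) (M : 'M[R]_n) (v : 'cV[R]_n) : R :=
  (v^T *m M *m v) 0 0.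

Definition posdef (R : realType) (n : nat) (M : 'M[R]_n) : Prop :=
  M^T = M /\ forall v : 'cV[R]_n, v != 0 -> 0 < qform M v.

Definition possemidef (R : realType) (n : nat) (M : 'M[R]_n) : Prop :=
  M^T = M /\ forall v : 'cV[R]_n, 0 <= qform M v.

(* Squared Euclidean norm; the library's norm on matrices is the max norm. *)
Definition sqnorm (R : realType) (p : nat) (v : 'cV[R]_p) : R :=
  \sum_(i < p) v i 0 ^+ 2.

(* All sequences below are indexed by nat, but only their values at the times
   k <= K (k <= K.+1 for the state and the Riccati unknowns) are constrained.
   The row dimensions of Phi1 k and Psi1 k are arbitrary and may depend on k. *)
Record mf_system (R : realType) (n q : nat) := MFSystem {
  A1 : nat -> 'M[R]_n;
  A1t : nat -> 'M[R]_n;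
  B1 : nat -> 'M[R]_n;
  B1t : nat -> 'M[R]_n;
  F1 : nat -> 'M[R]_(n, q);
  rowsPhi : nat -> nat;
  Phi1 : forall k, 'M[R]_(rowsPhi k, n);
  rowsPsi : nat -> nat;
  Psi1 : forall k, 'M[R]_(rowsPsi k, q)
}.

Section Riccati.
Context (R : realType) (n q : nat) (S : mf_system R n q).
Implicit Types (k : nat) (P Q : 'M[R]_n).

Definition AA1 k : 'M[R]_n := A1 S k + A1t S k.
Definition BB1 k : 'M[R]_n := B1 S k + B1t S k.

Definition L1 k P : 'M[R]_n :=
  (A1 S k)^T *m P *m A1 S k + (B1 S k)^T *m P *m B1 S k
  + (Phi1 S k)^T *m Phi1 S k.

Definition G1 k P : 'M[R]_(n, q) := (A1 S k)^T *m P *m F1 S k.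

Definition H1 k P : 'M[R]_q := 1%:M + (F1 S k)^T *m P *m F1 S k.

Definition L1t k P Q : 'M[R]_n :=
  (AA1 k)^T *m Q *m AA1 k + (BB1 k)^T *m P *m BB1 k
  + (Phi1 S k)^T *m Phi1 S k.

Definition G1t k P Q : 'M[R]_(n, q) := (AA1 k)^T *m Q *m F1 S k.

Definition H1t k P Q : 'M[R]_q := 1%:M + (F1 S k)^T *m Q *m F1 S k.

Definition riccati_solution (K : nat) (P Q : nat -> 'M[R]_n) : Prop :=
  [/\ forall k, (k <= K)%N -> (P k)^T = P k /\ (Q k)^T = Q k,
      forall k, (k <= K)%N ->
        P k = L1 k (P k.+1)
              - G1 k (P k.+1) *m invmx (H1 k (P k.+1)) *m (G1 k (P k.+1))^T,
      forall k, (k <= K)%N ->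
        Q k = L1t k (P k.+1) (Q k.+1)
              - G1t k (P k.+1) (Q k.+1) *m invmx (H1t k (P k.+1) (Q k.+1))
                *m (G1t k (P k.+1) (Q k.+1))^T,
      P K.+1 = 0 /\ Q K.+1 = 0
    & forall k, (k <= K)%N ->
        posdef (H1 k (P k.+1)) /\ posdef (H1t k (P k.+1) (Q k.+1))].

Definition riccati_unique_solution (K : nat) (P Q : nat -> 'M[R]_n) : Prop :=
  riccati_solution K P Q /\
  forall P' Q' : nat -> 'M[R]_n, riccati_solution K P' Q' ->
    forall k, (k <= K)%N -> P' k = P k /\ Q' k = Q k.

Definition feedback (P Q : nat -> 'M[R]_n) k (x m : 'cV[R]_n) : 'cV[R]_q :=
  - (invmx (H1 k (P k.+1)) *m (G1 k (P k.+1))^T *m x)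
  + (invmx (H1 k (P k.+1)) *m (G1 k (P k.+1))^T
     - invmx (H1t k (P k.+1) (Q k.+1)) *m (G1t k (P k.+1) (Q k.+1))^T) *m m.

End Riccati.

Section Stochastic.
Context (d : measure_display) (T : measurableType d) (R : realType).
Context (mu : probability T R).

Definition mean (p : nat) (X : T -> 'cV[R]_p) : 'cV[R]_p :=
  \col_i fine ('E_mu[fun t => X t i 0%R])%E.

(* [past omega k] is the sigma-algebra generated by omega 0, ..., omega (k-1),
   i.e. F_(k-1); for k = 0 it is trivial. *)
Definition past (omega : nat -> {RV mu >-> R}) (k : nat) : set (set T) :=
  g_sigma_preimage (fun i : 'I_k => omega i).

Definition noise (K : nat) (omega : nat -> {RV mu >-> R}) : Prop :=
  [/\ forall s, (s <= K)%N -> ('E_mu[omega s] = 0)%E,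
      forall s t, (s <= K)%N -> (t <= K)%N ->
        ('E_mu[fun w => (omega s w * omega t w)%R] = ((s == t)%:R)%R%:E)%E
    & forall k, (k <= K)%N ->
        forall (A : set T) (B : set R), past omega k A -> measurable B ->
          (mu (A `&` omega k @^-1` B) = mu A * mu (omega k @^-1` B))%E].

Definition in_l2 (K p : nat) (omega : nat -> {RV mu >-> R})
    (y : nat -> T -> 'cV[R]_p) : Prop :=
  forall k, (k <= K)%N -> forall i : 'I_p,
    (forall B : set R, measurable B ->
       past omega k ((fun t => y k t i 0) @^-1` B)) /\
    (fun t => y k t i 0) \in Lfun mu 2%:E.

Section System.
Context (n q : nat) (S : mf_system R n q).
Context (omega : nat -> {RV mu >-> R}) (x0 : 'cV[R]_n).

Fixpoint state (u : nat -> T -> 'cV[R]_q) (k : nat) : T -> 'cV[R]_n :=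
  if k is j.+1 then fun t =>
    A1 S j *m state u j t + A1t S j *m mean (state u j) + F1 S j *m u j t
    + omega j t *: (B1 S j *m state u j t + B1t S j *m mean (state u j))
  else fun=> x0.

Definition output (u : nat -> T -> 'cV[R]_q) (k : nat) (t : T) :
    'cV[R]_(rowsPhi S k + rowsPsi S k) :=
  col_mx (Phi1 S k *m state u k t) (Psi1 S k *m u k t).

Definition cost (K : nat) (u : nat -> T -> 'cV[R]_q) : \bar R :=
  (\sum_(k < K.+1) 'E_mu[fun t => sqnorm (output u k t)])%E.

End System.
End Stochastic.

(* Main.v *)
Require Import Defs.
From HB Require Import structures.
From mathcomp Require Import all_boot all_order all_algebra.
From mathcomp Require Import all_classical all_reals all_analysis.
From mathcomp Require Import measurable_realfun ring lra.

(* Split the state and the control into their means [m], [b] and the centred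
   parts [y = x - m], [v = u - b]. As [omega k] is centred, of unit variance
   and independent of F_(k-1), completing the square in [v] and in [b]
   separately shows that, for V_k := E[y^T P_k y] + m^T Q_k m,
   E|z_k|^2 + V_(k+1) - V_k is the nonnegative number
     E[(v + H^-1 G^T y)^T H (v + H^-1 G^T y)]
     + (b + Ht^-1 Gt^T m)^T Ht (b + Ht^-1 Gt^T m),
   which vanishes for the feedback law. Since V_(K+1) = 0 and
   V_0 = x0^T Q_0 x0, summing over k gives the optimal cost. *)

Set Implicit Arguments.
Unset Strict Implicit.
Unset Printing Implicit Defensive.

Import Order.TTheory GRing.Theory Num.Theory.

Local Open Scope classical_set_scope.
Local Open Scope ring_scope.

(** * Products of independent integrable random variables *)

Section IndependentProduct.
Context (d : measure_display) (T : measurableType d) (R : realType).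
Context (mu : probability T R) (X Y : {RV mu >-> R}).
Hypothesis indepXY : forall A B : set R, measurable A -> measurable B ->
  (mu (X @^-1` A `&` Y @^-1` B) = mu (X @^-1` A) * mu (Y @^-1` B))%E.

Let XY (t : T) : R * R := (X t, Y t).

Let measurable_XY : measurable_fun setT XY.
Proof. exact/measurable_fun_pair. Qed.

Let mXY : {mfun T >-> (R * R)%type} := mfun_Sub (mem_set measurable_XY).

(** Independence says that the law of the pair agrees with the product of the two laws on
    rectangles, and this determines a product measure. *)
Let integral_distribution_pair (f : R * R -> \bar R) :
  (\int[distribution mu mXY]_z f z =
   \int[distribution mu X \x distribution mu Y]_z f z)%E.
Proof.
apply/esym/eq_measure_integral => A mA _.
exact: product_measure_unique.
Qed.

Hypotheses (L1X : (X : T -> R) \in Lfun mu 1) (L1Y : (Y : T -> R) \in Lfun mu 1).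

Let mulE (z : R * R) : \bar R := (z.1 * z.2)%:E.

Let measurable_mulE : measurable_fun setT mulE.
Proof.
by apply/measurable_EFinP; apply: measurable_funM.
Qed.

(** By Tonelli, the integral of |xy| against the product law factors as E|X| times E|Y|, which is
    finite. *)
Lemma indep_Lfun1M : X \* Y \in Lfun mu 1.
Proof.
apply/Lfun1_integrable/integrableP; split.
  by apply/measurable_EFinP; exact: measurable_funM.
pose f (z : R * R) := `|mulE z|%E.
have mf : measurable_fun setT f by exact: measurableT_comp.
have f0 z : (0 <= f z)%E by exact: abse_ge0.
rewrite -[ltLHS](_ : \int[distribution mu mXY]_z f z = _)%E; last first.
  by rewrite ge0_integral_pushforward.
rewrite integral_distribution_pair fubini_tonelli1//.
rewrite ge0_integral_pushforward//=; last 2 first.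
- exact: measurable_fun_fubini_tonelli_F.
- by move=> x _; exact: integral_ge0.
have /Lfun1_integrable/integrableP[mX intX] := L1X.
have /Lfun1_integrable/integrableP[mY intY] := L1Y.
under eq_integral => s _.
  rewrite /= /fubini_F ge0_integral_pushforward//; last first.
    exact: measurableT_comp.
  rewrite preimage_setT /f /mulE /=.
  under eq_integral do rewrite normrM EFinM.
  rewrite ge0_integralZl//; last first.
    by apply/measurable_EFinP; exact: measurableT_comp.
  over.
rewrite preimage_setT ge0_integralZr//=; last 2 first.
- by apply/measurable_EFinP; exact: measurableT_comp.
- exact: integral_ge0.
by rewrite lte_mul_pinfty// ?ge0_fin_numE// integral_ge0.
Qed.

Lemma indep_expectationM : ('E_mu[X \* Y] = 'E_mu[X] * 'E_mu[Y])%E.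
Proof.
pose f := mulE.
have intXY : mu.-integrable setT (f \o mXY).
  exact/Lfun1_integrable/indep_Lfun1M.
(* The joint law has the same integrals as the product law, so integrability passes to the product
   space, as Fubini requires. *)
have intf : (distribution mu X \x distribution mu Y)%E.-integrable setT f.
  apply/integrableP; split => //.
  rewrite -integral_distribution_pair.
  rewrite ge0_integral_pushforward//; last exact: measurableT_comp.
  by have /integrableP[] := intXY.
have /Lfun1_integrable intX := L1X.
have /Lfun1_integrable intY := L1Y.
rewrite unlock.
transitivity (\int[distribution mu mXY]_z f z)%E.
  by rewrite integral_pushforward.
rewrite integral_distribution_pair -integral12_prod_meas1//.
have fubE : fubini_F (distribution mu Y) f =
    (fun x => x%:E * \int[mu]_t (Y t)%:E)%E.
  apply/funext => s; rewrite /fubini_F integral_pushforward//=.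
  - rewrite /f /mulE /=; under eq_integral do rewrite EFinM.
    by rewrite preimage_setT integralZl.
  - exact: measurableT_comp.
  - by apply: (@eq_integrable _ _ _ _ _ measurableT
      (fun t => s%:E * (Y t)%:E)%E) => //; exact: integrableZl.
rewrite fubE.
rewrite integral_pushforward//=.
- by rewrite preimage_setT -(fineK (integrable_fin_num _ intY))//= integralZr.
- by apply: emeasurable_funM => //; exact: measurable_cst.
- rewrite -(fineK (integrable_fin_num _ intY))//= preimage_setT.
  exact: (integrableZr measurableT _ intX).
Qed.

End IndependentProduct.

(** * Bilinear and quadratic forms *)

Section BilinearForms.
Context (R : realType).
Implicit Types n p : nat.

(** Rectangular forms are needed for the cross terms between a state in R^n and a control in R^q. *)
Definition bform n p (M : 'M[R]_(n, p)) (x : 'cV[R]_n) (y : 'cV[R]_p) : R :=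
  (x^T *m M *m y) 0 0.

Lemma qformE n (M : 'M[R]_n) x : qform M x = bform M x x.
Proof. by []. Qed.

Lemma bformE n p (M : 'M[R]_(n, p)) x y :
  bform M x y = \sum_i \sum_j M i j * (x i 0 * y j 0).
Proof.
rewrite /bform -mulmxA mxE; apply: eq_bigr => i _.
rewrite !mxE mulr_sumr; apply: eq_bigr => j _.
by rewrite mulrCA mulrA.
Qed.

Lemma bformDl n p (M : 'M[R]_(n, p)) x x' y :
  bform M (x + x') y = bform M x y + bform M x' y.
Proof. by rewrite /bform linearD /= !mulmxDl mxE. Qed.

Lemma bformDr n p (M : 'M[R]_(n, p)) x y y' :
  bform M x (y + y') = bform M x y + bform M x y'.
Proof. by rewrite /bform mulmxDr mxE. Qed.

Lemma bformZl n p (M : 'M[R]_(n, p)) a x y :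
  bform M (a *: x) y = a * bform M x y.
Proof. by rewrite /bform linearZ /= -!scalemxAl mxE. Qed.

Lemma bformZr n p (M : 'M[R]_(n, p)) a x y :
  bform M x (a *: y) = a * bform M x y.
Proof. by rewrite /bform -scalemxAr mxE. Qed.

Lemma bformDm n p (M N : 'M[R]_(n, p)) x y :
  bform (M + N) x y = bform M x y + bform N x y.
Proof. by rewrite /bform mulmxDr mulmxDl mxE. Qed.

Lemma bformNm n p (M : 'M[R]_(n, p)) x y : bform (- M) x y = - bform M x y.
Proof. by rewrite /bform mulmxN mulNmx mxE. Qed.

Lemma bform_mull m n p (A : 'M[R]_(n, m)) (M : 'M[R]_(n, p)) x y :
  bform M (A *m x) y = bform (A^T *m M) x y.
Proof. by rewrite /bform trmx_mul !mulmxA. Qed.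

Lemma bform_mulr m n p (A : 'M[R]_(p, m)) (M : 'M[R]_(n, p)) x y :
  bform M x (A *m y) = bform (M *m A) x y.
Proof. by rewrite /bform !mulmxA. Qed.

Lemma bform_tr n p (M : 'M[R]_(n, p)) x y : bform M x y = bform M^T y x.
Proof.
rewrite !bformE exchange_big; apply: eq_bigr => i _; apply: eq_bigr => j _.
by rewrite mxE [x j 0 * _]mulrC.
Qed.

Lemma qform_mul m n (A : 'M[R]_(n, m)) (M : 'M[R]_n) x :
  qform M (A *m x) = qform (A^T *m M *m A) x.
Proof. by rewrite !qformE bform_mull bform_mulr. Qed.

Lemma qformDm n (M N : 'M[R]_n) x : qform (M + N) x = qform M x + qform N x.
Proof. exact: bformDm. Qed.

Lemma qform0 n (x : 'cV[R]_n) : qform 0 x = 0.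
Proof. by rewrite /qform mulmx0 mul0mx mxE. Qed.

Lemma qform_vec0 n (M : 'M[R]_n) : qform M 0 = 0.
Proof. by rewrite /qform mulmx0 mxE. Qed.

Lemma sqnorm_ge0 n (x : 'cV[R]_n) : 0 <= sqnorm x.
Proof. by apply: sumr_ge0 => i _; exact: sqr_ge0. Qed.

Lemma sqnormE n (x : 'cV[R]_n) : sqnorm x = qform 1%:M x.
Proof.
rewrite /qform mulmx1 mxE; apply: eq_bigr => i _.
by rewrite mxE expr2.
Qed.

Lemma sqnorm_mul m n (A : 'M[R]_(m, n)) x :
  sqnorm (A *m x) = qform (A^T *m A) x.
Proof. by rewrite sqnormE qform_mul mulmx1. Qed.

Lemma sqnorm_col_mx m n (x : 'cV[R]_m) (y : 'cV[R]_n) :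
  sqnorm (col_mx x y) = sqnorm x + sqnorm y.
Proof.
rewrite /sqnorm big_split_ord /=; congr (_ + _); apply: eq_bigr => i _.
  by rewrite col_mxEu.
by rewrite col_mxEd.
Qed.

Lemma posdef_unitmx n (M : 'M[R]_n) : posdef M -> M \in unitmx.
Proof.
move=> [_ Mpos]; rewrite -row_free_unit; apply: inj_row_free => v vM.
apply/eqP/negPn/negP => v0.
have /Mpos : v^T != 0 by apply: contra_neq v0 => /(canRL trmxK); rewrite trmx0.
by rewrite /qform trmxK vM mul0mx mxE ltxx.
Qed.

Lemma posdef_qform_ge0 n (M : 'M[R]_n) x : posdef M -> 0 <= qform M x.
Proof.
move=> [_ Mpos]; have [->|/Mpos/ltW//] := eqVneq x 0.
by rewrite qform_vec0.
Qed.

(** Symmetry of [W] makes [H] symmetric, so the square on the right expands into v^T H v, the merged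
    cross term 2 y^T G v, and y^T G H^-1 G^T y, which cancels the correction subtracted in the first
    form. *)
Lemma complete_square n q (A W : 'M[R]_n) (F : 'M[R]_(n, q)) y v :
  let G := A^T *m W *m F in
  let H := 1%:M + F^T *m W *m F in
  W^T = W -> H \in unitmx ->
  qform W (A *m y + F *m v) + qform 1%:M v =
  qform (A^T *m W *m A - G *m invmx H *m G^T) y
  + qform H (v + invmx H *m G^T *m y).
Proof.
move=> G H WT Hu.
have GT : G^T = F^T *m W *m A by rewrite /G !trmx_mul trmxK WT mulmxA.
have HT : H^T = H.
  by rewrite /H linearD /= trmx1 !trmx_mul trmxK WT mulmxA.
have HE x : qform H x = qform 1%:M x + qform (F^T *m W *m F) x.
  exact: qformDm.
have GE : A^T *m W *m F = G by [].
(* [G] and [H] become opaque, so that the expansion into bilinear forms cannot open them; the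
   equations kept are the facts that it needs. *)
move: G H HT GT HE GE Hu => G H HT GT HE GE Hu.
rewrite [qform H _]qformE !(bformDl, bformDr) -[bform H v v]/(qform H v) HE.
rewrite !qformE !(bformDl, bformDr, bformDm, bformNm, bform_mull, bform_mulr).
rewrite GE -GT trmx_mul trmxK trmx_inv HT mulmxA.
rewrite mulmxV // mul1mx !mulmxKV // [bform G^T v y]bform_tr trmxK mulmxA.
ring.
Qed.

End BilinearForms.

(** * Real-valued expectation and square-integrable vectors *)

Section Expectation.
Context (d : measure_display) (T : measurableType d) (R : realType).
Context (mu : probability T R).
Implicit Types f g : T -> R.

(** [fine] sends infinite expectations to 0, so the linearity rules below carry integrability
    hypotheses. The coordinates of [mean] have this form. *)
Definition Ex f : R := fine ('E_mu[f])%E.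

Lemma LfunD (r : R) f g : 1 <= r -> f \in Lfun mu r%:E -> g \in Lfun mu r%:E ->
  (fun t => f t + g t) \in Lfun mu r%:E.
Proof. by move=> r1; have [_] := Lfun_addr_closed mu (r1 : (1 <= r%:E)%E); apply. Qed.

Lemma LfunZ (r a : R) f : 1 <= r -> f \in Lfun mu r%:E ->
  (fun t => a * f t) \in Lfun mu r%:E.
Proof.
move=> r1 fr; under eq_fun do rewrite mulrC.
exact: Lfun_scale.
Qed.

Lemma Lfun_sum (r : R) (I : finType) (F : I -> T -> R) : 1 <= r ->
  (forall i, F i \in Lfun mu r%:E) ->
  (fun t => \sum_i F i t) \in Lfun mu r%:E.
Proof.
move=> r1 Fr; rewrite -[X in X \in _]/(fun t => \sum_(i <- _) F i t).
elim: (index_enum I) => [|i s IHs].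
  by under eq_fun do rewrite big_nil; exact: Lfun_cst.
by under eq_fun do rewrite big_cons; exact: LfunD.
Qed.

Lemma Lfun21 f : f \in Lfun mu 2%:E -> f \in Lfun mu 1.
Proof. by apply: Lfun_subset12; exact: fin_num_measure. Qed.

(** Used where the square can be controlled: by the variance for the noise, by independence for
    noise times a past variable. *)
Lemma Lfun_sqr2 f : measurable_fun setT f ->
  (fun t => f t ^+ 2) \in Lfun mu 1 -> f \in Lfun mu 2%:E.
Proof.
move=> mf /Lfun1_integrable/integrableP[_ f2].
rewrite inE; apply/andP; split; rewrite inE//= /finite_norm unlock /Lnorm.
apply: poweR_lty; apply: le_lt_trans f2.
rewrite le_eqVlt; apply/orP; left; apply/eqP; apply: eq_integral => t _ /=.
by rewrite normrX powR_mulrn.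
Qed.

Lemma ExK f : f \in Lfun mu 1 -> ('E_mu[f] = (Ex f)%:E)%E.
Proof. by move=> /expectation_fin_num/fineK. Qed.

Lemma Ex_cst a : Ex (fun=> a) = a.
Proof. by rewrite /Ex expectation_cst. Qed.

Lemma ExD f g : f \in Lfun mu 1 -> g \in Lfun mu 1 ->
  Ex (fun t => f t + g t) = Ex f + Ex g.
Proof.
by move=> f1 g1; rewrite /Ex expectationD// fineD// expectation_fin_num.
Qed.

Lemma ExZ a f : f \in Lfun mu 1 -> Ex (fun t => a * f t) = a * Ex f.
Proof.
move=> f1; rewrite /Ex; under eq_fun do rewrite mulrC.
by rewrite expectationZl// fineM// expectation_fin_num.
Qed.

Lemma Ex_sum (I : finType) (F : I -> T -> R) :
  (forall i, F i \in Lfun mu 1) ->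
  Ex (fun t => \sum_i F i t) = \sum_i Ex (F i).
Proof.
move=> F1; rewrite -[X in Ex X]/(fun t => \sum_(i <- _) F i t).
(* Integrability of partial sums is proved along with the formula, since additivity at each step
   requires it. *)
suff : (fun t => \sum_(i <- index_enum I) F i t) \in Lfun mu 1 /\
  Ex (fun t => \sum_(i <- index_enum I) F i t) = \sum_i Ex (F i) by case.
elim: (index_enum I) => [|i s [IHs1 IHs2]].
  split; under eq_fun do rewrite big_nil; first exact: Lfun_cst.
  by rewrite big_nil Ex_cst.
split; under eq_fun do rewrite big_cons; first exact: LfunD.
by rewrite big_cons ExD// IHs2.
Qed.

Lemma Ex_ge0 f : (forall t, 0 <= f t) -> 0 <= Ex f.
Proof. by move=> f0; rewrite fine_ge0// expectation_ge0. Qed.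

Definition L2vec p (X : T -> 'cV[R]_p) : Prop :=
  forall i, (fun t => X t i 0) \in Lfun mu 2%:E.

Lemma L2vec_cst p (c : 'cV[R]_p) : L2vec (fun=> c).
Proof. by move=> i; exact: Lfun_cst. Qed.

Lemma L2vecD p (X Y : T -> 'cV[R]_p) :
  L2vec X -> L2vec Y -> L2vec (fun t => X t + Y t).
Proof.
by move=> hX hY i; under eq_fun do rewrite mxE; apply: LfunD => //; rewrite ler1n.
Qed.

Lemma L2vec_mul m p (A : 'M[R]_(m, p)) (X : T -> 'cV[R]_p) :
  L2vec X -> L2vec (fun t => A *m X t).
Proof.
move=> hX i; under eq_fun do rewrite mxE.
by apply: Lfun_sum => [|j]; [rewrite ler1n|apply: LfunZ; rewrite ?ler1n].
Qed.

Lemma bform_Lfun1 n p (M : 'M[R]_(n, p)) X Y : L2vec X -> L2vec Y ->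
  (fun t => bform M (X t) (Y t)) \in Lfun mu 1.
Proof.
move=> hX hY; under eq_fun do rewrite bformE.
apply: Lfun_sum => // i; apply: Lfun_sum => // j; apply: LfunZ => //.
exact: Lfun2_mul_Lfun1.
Qed.

Lemma mean_cst p (c : 'cV[R]_p) : mean mu (fun=> c) = c.
Proof. by apply/colP => i; rewrite mxE -/(Ex _) Ex_cst. Qed.

Lemma meanD p (X Y : T -> 'cV[R]_p) : L2vec X -> L2vec Y ->
  mean mu (fun t => X t + Y t) = mean mu X + mean mu Y.
Proof.
move=> hX hY; apply/colP => i; rewrite !mxE -!/(Ex _) -ExD//; last 2 first.
- exact: Lfun21.
- exact: Lfun21.
by congr Ex; apply/funext => t; rewrite mxE.
Qed.

Lemma mean_mul m p (A : 'M[R]_(m, p)) (X : T -> 'cV[R]_p) : L2vec X ->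
  mean mu (fun t => A *m X t) = A *m mean mu X.
Proof.
move=> hX; apply/colP => i; rewrite !mxE -/(Ex _).
under eq_fun do rewrite mxE.
rewrite Ex_sum => [|j]; last by apply: LfunZ => //; exact: Lfun21.
by apply: eq_bigr => j _; rewrite ExZ ?mxE//; exact: Lfun21.
Qed.

(** With [c] fixed the form is a linear function of [X], given by a one-row matrix, and [mean]
    commutes with matrices. *)
Lemma Ex_bform_cst n p (M : 'M[R]_(n, p)) X c : L2vec X ->
  Ex (fun t => bform M (X t) c) = bform M (mean mu X) c.
Proof.
move=> hX; have hMX := L2vec_mul (c^T *m M^T) hX.
have bE x : bform M x c = ((c^T *m M^T) *m x) 0 0.
  by rewrite bform_tr.
rewrite bE -mean_mul// mxE -/(Ex _); congr Ex.
by apply/funext => t; rewrite bE.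
Qed.

(** The decomposition of a second moment into variance and squared mean: both cross terms are linear
    in the centred [X]. *)
Lemma Ex_qformD_cst n (M : 'M[R]_n) X c : L2vec X -> mean mu X = 0 ->
  Ex (fun t => qform M (X t + c)) = Ex (fun t => qform M (X t)) + qform M c.
Proof.
move=> hX X0; have hc : L2vec (fun=> c) by exact: L2vec_cst.
(* Needed for [M] and for its transpose, hence the general [N]. *)
have E0 (N : 'M[R]_n) : Ex (fun t => bform N (X t) c) = 0.
  by rewrite Ex_bform_cst// X0 /bform trmx0 !mul0mx mxE.
under eq_fun do rewrite qformE bformDl !bformDr [bform M c (X _)]bform_tr.
rewrite !ExD ?E0 ?Ex_cst ?addr0 ?add0r//; try exact: bform_Lfun1.
- by apply: LfunD => //; exact: bform_Lfun1.
- by apply: LfunD => //; [exact: bform_Lfun1|exact: Lfun_cst].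
Qed.

Lemma sub_mean_L2vec p (X : T -> 'cV[R]_p) : L2vec X ->
  L2vec (fun t => X t - mean mu X).
Proof. by move=> hX; apply: L2vecD => //; exact: L2vec_cst. Qed.

Lemma mean_sub_mean p (X : T -> 'cV[R]_p) : L2vec X ->
  mean mu (fun t => X t - mean mu X) = 0.
Proof.
by move=> hX; rewrite meanD ?mean_cst ?subrr//; exact: L2vec_cst.
Qed.

End Expectation.

(** * The filtration of the noise and adapted vectors *)

Section Filtration.
Context (d : measure_display) (T : measurableType d) (R : realType).
Context (mu : probability T R) (omega : nat -> {RV mu >-> R}).
Implicit Types (f : T -> R) (k : nat).

(** Generators of F_(k-1): [past omega k] unfolds to the sigma-algebra that they generate. *)
Let gen k : set (set T) :=
  \big[setU/set0]_(i < k) preimage_set_system setT (omega i) measurable.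

Definition past_meas k f : Prop :=
  forall B : set R, measurable B -> past omega k (f @^-1` B).

(** Makes the closure properties of measurable functions available for F_(k-1). *)
Lemma past_measP k f :
  past_meas k f <-> measurable_fun setT (f : g_sigma_algebraType (gen k) -> R).
Proof.
split=> [hf _ B mB|hf B mB].
  by rewrite setTI; exact: hf.
by rewrite -[_ @^-1` _]setTI; exact: hf.
Qed.

Lemma past_meas_cst k a : past_meas k (fun=> a).
Proof. by apply/past_measP; exact: measurable_cst. Qed.

Lemma past_measD k f g : past_meas k f -> past_meas k g ->
  past_meas k (fun t => f t + g t).
Proof. by move=> /past_measP hf /past_measP hg; exact/past_measP/measurable_funD. Qed.

Lemma past_measM k f g : past_meas k f -> past_meas k g ->
  past_meas k (fun t => f t * g t).
Proof. by move=> /past_measP hf /past_measP hg; exact/past_measP/measurable_funM. Qed.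

Lemma past_meas_sum k (I : finType) (F : I -> T -> R) :
  (forall i, past_meas k (F i)) -> past_meas k (fun t => \sum_i F i t).
Proof.
move=> hF; rewrite -[X in past_meas k X]/(fun t => \sum_(i <- _) F i t).
elim: (index_enum I) => [|i s IHs].
  by under eq_fun do rewrite big_nil; exact: past_meas_cst.
by under eq_fun do rewrite big_cons; exact: past_measD.
Qed.

Lemma gen_sub k : gen k `<=` gen k.+1.
Proof. by move=> A; rewrite /gen big_ord_recr /=; left. Qed.

Lemma past_measS k f : past_meas k f -> past_meas k.+1 f.
Proof. by move=> hf B /hf; exact: (sub_sigma_algebra2 (@gen_sub k)). Qed.

Lemma past_meas_noise k : past_meas k.+1 (omega k).
Proof.
move=> B mB; apply: sub_sigma_algebra; rewrite big_ord_recr /=; right.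
by exists B => //; rewrite setTI.
Qed.

(** One time slice of [in_l2]: [in_l2 K omega u] unfolds to [adapted omega k (u k)] for all
    [k <= K]. *)
Definition adapted k p (X : T -> 'cV[R]_p) : Prop :=
  forall i, past_meas k (fun t => X t i 0) /\
            (fun t => X t i 0) \in Lfun mu 2%:E.

Lemma adapted_L2vec k p (X : T -> 'cV[R]_p) : adapted k X -> L2vec mu X.
Proof. by move=> hX i; case: (hX i). Qed.

Lemma adapted_past_meas k p (X : T -> 'cV[R]_p) i :
  adapted k X -> past_meas k (fun t => X t i 0).
Proof. by move=> hX; case: (hX i). Qed.

Lemma adapted_cst k p (c : 'cV[R]_p) : adapted k (fun=> c).
Proof. by move=> i; split; [exact: past_meas_cst|exact: Lfun_cst]. Qed.

Lemma adaptedS k p (X : T -> 'cV[R]_p) : adapted k X -> adapted k.+1 X.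
Proof. by move=> hX i; case: (hX i) => hXi ?; split => //; exact: past_measS. Qed.

Lemma adaptedD k p (X Y : T -> 'cV[R]_p) : adapted k X -> adapted k Y ->
  adapted k (fun t => X t + Y t).
Proof.
move=> hX hY i; split.
  by under eq_fun do rewrite mxE; apply: past_measD; exact: adapted_past_meas.
exact: (L2vecD (adapted_L2vec hX) (adapted_L2vec hY) i).
Qed.

Lemma adapted_mul k m p (A : 'M[R]_(m, p)) (X : T -> 'cV[R]_p) :
  adapted k X -> adapted k (fun t => A *m X t).
Proof.
move=> hX i; split; last exact: (L2vec_mul A (adapted_L2vec hX)).
under eq_fun do rewrite mxE.
apply: past_meas_sum => j; apply: past_measM; first exact: past_meas_cst.
exact: adapted_past_meas.
Qed.

Lemma past_meas_bform k n p (M : 'M[R]_(n, p)) X Y :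
  adapted k X -> adapted k Y -> past_meas k (fun t => bform M (X t) (Y t)).
Proof.
move=> hX hY; under eq_fun do rewrite bformE.
apply: past_meas_sum => i; apply: past_meas_sum => j.
apply: past_measM; first exact: past_meas_cst.
by apply: past_measM; exact: adapted_past_meas.
Qed.

(** * Moments of the noise against the past *)

Section Noise.
Context (K : nat).
Hypothesis noise_omega : noise K omega.

Lemma noise_sqr_Lfun1 k : (k <= K)%N -> (fun t => omega k t ^+ 2) \in Lfun mu 1.
Proof.
move=> kK; have [_ /(_ k k kK kK) + _] := noise_omega.
rewrite eqxx unlock => E1; apply/Lfun1_integrable/integrableP; split.
  by apply/measurable_EFinP; exact: measurable_funX.
rewrite (_ : (\int[mu]_x _)%E = 1%E) ?ltry// -[RHS]E1.
by apply: eq_integral => t _; rewrite /= ger0_norm ?sqr_ge0// expr2.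
Qed.

Lemma noise_Lfun2 k : (k <= K)%N -> (omega k : T -> R) \in Lfun mu 2%:E.
Proof. by move=> kK; apply: Lfun_sqr2 => //; exact: noise_sqr_Lfun1. Qed.

Lemma Ex_noise k : (k <= K)%N -> Ex mu (omega k) = 0.
Proof.
by move=> kK; have [/(_ k kK) E0 _ _] := noise_omega; rewrite /Ex E0.
Qed.

Lemma Ex_noise_sqr k : (k <= K)%N -> Ex mu (fun t => omega k t ^+ 2) = 1.
Proof.
by move=> kK; have [_ /(_ k k kK kK) + _] := noise_omega; rewrite eqxx /Ex => ->.
Qed.

(** Events of [f] lie in F_(k-1) and events of [g \o omega k] are events of [omega k], so the two
    are independent. It is applied with [g] the identity and the square. *)
Lemma past_noiseM k f (g : R -> R) : (k <= K)%N ->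
  past_meas k f -> f \in Lfun mu 1 ->
  measurable_fun setT g -> g \o omega k \in Lfun mu 1 ->
  (fun t => f t * g (omega k t)) \in Lfun mu 1 /\
  Ex mu (fun t => f t * g (omega k t)) = Ex mu f * Ex mu (g \o omega k).
Proof.
move=> kK hf f1 mg g1.
have [_ _ /(_ k kK) indep] := noise_omega.
pose F : {RV mu >-> R} := mfun_Sub (sub_Lfun_mfun f1).
pose G : {RV mu >-> R} := mfun_Sub (sub_Lfun_mfun g1).
have indepFG (A B : set R) : measurable A -> measurable B ->
    (mu (F @^-1` A `&` G @^-1` B) = mu (F @^-1` A) * mu (G @^-1` B))%E.
  move=> mA mB; apply: (indep (F @^-1` A) (g @^-1` B)); first exact: hf.
  by rewrite -[_ @^-1` _]setTI; exact: mg.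
split; first exact: (indep_Lfun1M indepFG).
have := indep_expectationM indepFG f1 g1.
by rewrite /Ex -fineM ?expectation_fin_num// => <-.
Qed.

Lemma past_noise_sqr k f : (k <= K)%N -> past_meas k f -> f \in Lfun mu 1 ->
  (fun t => omega k t ^+ 2 * f t) \in Lfun mu 1 /\
  Ex mu (fun t => omega k t ^+ 2 * f t) = Ex mu f.
Proof.
move=> kK hf f1; under eq_fun do rewrite mulrC.
have := @past_noiseM k f (fun x => x ^+ 2) kK hf f1.
rewrite Ex_noise_sqr// mulr1; apply; first exact: measurable_funX.
exact: noise_sqr_Lfun1.
Qed.

Lemma past_noise k f : (k <= K)%N -> past_meas k f -> f \in Lfun mu 1 ->
  (fun t => omega k t * f t) \in Lfun mu 1 /\
  Ex mu (fun t => omega k t * f t) = 0.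
Proof.
move=> kK hf f1; under eq_fun do rewrite mulrC.
have := @past_noiseM k f id kK hf f1.
rewrite Ex_noise// mulr0; apply => //.
by apply: Lfun21; exact: noise_Lfun2.
Qed.

(** A product of two L2 functions is in general only in L1; here independence gives
    E[omega_k^2 X_i^2] = E[X_i^2], which is finite. *)
Lemma adapted_noise k p (X : T -> 'cV[R]_p) : (k <= K)%N ->
  adapted k X -> adapted k.+1 (fun t => omega k t *: X t).
Proof.
move=> kK hX i; under eq_fun do rewrite mxE.
have [hXi Xi2] := hX i; split.
  by apply: past_measM; [exact: past_meas_noise|exact: past_measS].
apply: Lfun_sqr2.
  by apply: measurable_funM => //; have := sub_Lfun_mfun Xi2; rewrite inE.
under eq_fun do rewrite exprMn.
apply: (proj1 (past_noise_sqr kK _ _)).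
  by under eq_fun do rewrite expr2; exact: past_measM.
by apply/Lfun1_integrable; exact: Lfun2_integrable_sqr.
Qed.

Lemma mean_noise k p (X : T -> 'cV[R]_p) : (k <= K)%N ->
  adapted k X -> mean mu (fun t => omega k t *: X t) = 0.
Proof.
move=> kK hX; apply/colP => i; have [hXi Xi2] := hX i.
rewrite !mxE -/(Ex _ _); under eq_fun do rewrite mxE.
exact: (proj2 (past_noise kK hXi (Lfun21 Xi2))).
Qed.

(* The cross term is linear in [omega k], hence has zero mean. *)
Lemma Ex_qformD_noise k n (M : 'M[R]_n) X Y : (k <= K)%N ->
  adapted k X -> adapted k Y ->
  Ex mu (fun t => qform M (X t + omega k t *: Y t)) =
  Ex mu (fun t => qform M (X t)) + Ex mu (fun t => qform M (Y t)).
Proof.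
move=> kK hX hY.
have hX2 := adapted_L2vec hX; have hY2 := adapted_L2vec hY.
have [XY1 XY0] := past_noise kK (past_meas_bform M hX hY) (bform_Lfun1 M hX2 hY2).
have [YX1 YX0] := past_noise kK (past_meas_bform M hY hX) (bform_Lfun1 M hY2 hX2).
have [YY1 YY0] :=
  past_noise_sqr kK (past_meas_bform M hY hY) (bform_Lfun1 M hY2 hY2).
under eq_fun do
  rewrite qformE !(bformDl, bformDr, bformZl, bformZr) mulrA -expr2.
have XX1 := bform_Lfun1 M hX2 hX2.
rewrite !ExD//; [|exact: LfunD|exact: LfunD].
by rewrite XY0 YX0 YY0 addr0 add0r.
Qed.

End Noise.
End Filtration.

(** * One backward step of the Riccati equations *)

Section RiccatiStep.
Context (R : realType) (n q : nat) (S : mf_system R n q).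

(** The centred part of the optimal control is minus this gain times the centred state; [gaint] does
    the same for the means. *)
Definition gain k (P : 'M[R]_n) : 'M[R]_(q, n) :=
  invmx (H1 S k P) *m (G1 S k P)^T.

Definition gaint k (P Q : 'M[R]_n) : 'M[R]_(q, n) :=
  invmx (H1t S k P Q) *m (G1t S k P Q)^T.

(** The square is completed in [A1] and [F1]; the [B1] and [Phi1] terms do not involve [v] and
    complete the matrix to that of the Riccati equation. *)
Lemma riccati_square k (P : 'M[R]_n) y v : P^T = P -> posdef (H1 S k P) ->
  qform P (A1 S k *m y + F1 S k *m v) + qform P (B1 S k *m y)
  + sqnorm (Phi1 S k *m y) + sqnorm v =
  qform (L1 S k P - G1 S k P *m invmx (H1 S k P) *m (G1 S k P)^T) y
  + qform (H1 S k P) (v + gain k P *m y).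
Proof.
move=> PT /posdef_unitmx Hu.
have E : qform P (A1 S k *m y + F1 S k *m v) + qform 1%:M v =
    qform ((A1 S k)^T *m P *m A1 S k
           - G1 S k P *m invmx (H1 S k P) *m (G1 S k P)^T) y
    + qform (H1 S k P) (v + gain k P *m y) := complete_square (A1 S k) y v PT Hu.
rewrite [sqnorm v]sqnormE sqnorm_mul [qform P (B1 S k *m y)]qform_mul /L1.
by move: E; rewrite !qformDm; lra.
Qed.

(** The counterpart for the means. The term in [BB1] is weighted by [P], not [Q]: multiplied by the
    centred noise, it contributes to the fluctuation of the next state and not to its mean. *)
Lemma riccatit_square k (P Q : 'M[R]_n) m v :
  Q^T = Q -> posdef (H1t S k P Q) ->
  qform Q (AA1 S k *m m + F1 S k *m v) + qform P (BB1 S k *m m)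
  + sqnorm (Phi1 S k *m m) + sqnorm v =
  qform (L1t S k P Q
         - G1t S k P Q *m invmx (H1t S k P Q) *m (G1t S k P Q)^T) m
  + qform (H1t S k P Q) (v + gaint k P Q *m m).
Proof.
move=> QT /posdef_unitmx Hu.
have E : qform Q (AA1 S k *m m + F1 S k *m v) + qform 1%:M v =
    qform ((AA1 S k)^T *m Q *m AA1 S k
           - G1t S k P Q *m invmx (H1t S k P Q) *m (G1t S k P Q)^T) m
    + qform (H1t S k P Q) (v + gaint k P Q *m m) :=
  complete_square (AA1 S k) m v QT Hu.
rewrite [sqnorm v]sqnormE sqnorm_mul [qform P (BB1 S k *m m)]qform_mul /L1t.
by move: E; rewrite !qformDm; lra.
Qed.


Lemma riccati_solution_sym K (P Q : nat -> 'M[R]_n) k :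
  riccati_solution S K P Q -> (k <= K.+1)%N -> (P k)^T = P k /\ (Q k)^T = Q k.
Proof.
move=> [PQT _ _ [PK QK] _]; rewrite leq_eqVlt => /predU1P[->|]; last exact: PQT.
by rewrite PK QK !trmx0.
Qed.

(** At the control equal to minus the gain times [x] the completed square vanishes, which leaves the
    form at [x] as a sum of nonnegative terms. Hence positivity passes from time i+1 to time i. *)
Lemma riccati_possemidef K (P Q : nat -> 'M[R]_n) k : riccati_solution S K P Q ->
  (k <= K.+1)%N -> possemidef (P k) /\ possemidef (Q k).
Proof.
move=> PQ; have sym j := @riccati_solution_sym K P Q j PQ.
have [_ PE QE [PK QK] PQH] := PQ.
(* Backward induction from K+1, written as induction on the distance [j] to the terminal time. *)
move=> kK; rewrite -(subKn kK); elim: (K.+1 - k)%N (leq_subr k K.+1) => [_|j IHj jK].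
  rewrite subn0 PK QK; split; split; rewrite ?trmx0// => v; by rewrite qform0.
have [IHP IHQ] := IHj (ltnW jK).
set i := (K.+1 - j.+1)%N; have iK : (i <= K)%N by rewrite /i subSS leq_subr.
have iS : (K.+1 - j)%N = i.+1 by rewrite /i subnSK.
rewrite iS in IHP IHQ.
have [PT QT] := sym i.+1 iK; have [PT0 QT0] := sym i (leqW iK).
have [HP HQ] := PQH i iK.
split; split=> // x.
  have := riccati_square x (- (gain i (P i.+1) *m x)) PT HP.
  rewrite addNr qform_vec0 addr0 -PE// => <-.
  by rewrite !addr_ge0 ?sqnorm_ge0//; apply IHP.
have := riccatit_square x (- (gaint i (P i.+1) (Q i.+1) *m x)) QT HQ.
rewrite addNr qform_vec0 addr0 -QE// => <-.
by rewrite !addr_ge0 ?sqnorm_ge0//; [apply IHQ|apply IHP].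
Qed.

End RiccatiStep.

(** * Stage costs and the telescoping sum *)

Section Cost.
Context (d : measure_display) (T : measurableType d) (R : realType).
Context (mu : probability T R) (n q K : nat) (S : mf_system R n q).
Context (omega : nat -> {RV mu >-> R}) (x0 : 'cV[R]_n).
Hypothesis noise_omega : noise K omega.
Hypothesis Psi_orth :
  forall k, (k <= K)%N -> (Psi1 S k)^T *m Psi1 S k = 1%:M.
Context (P Q : nat -> 'M[R]_n).
Hypothesis PQ : riccati_solution S K P Q.

(** Only the control at time [k] is mentioned, so that the closed loop, whose controls are shown to
    be adapted one step at a time, is covered as well. *)
Lemma adapted_stateS u k : (k <= K)%N ->
  adapted omega k (state S omega x0 u k) -> adapted omega k (u k) ->
  adapted omega k.+1 (state S omega x0 u k.+1).
Proof.
move=> kK hx hu /=.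
apply: adaptedD.
  apply: adaptedS; apply: adaptedD; last exact: adapted_mul.
  by apply: adaptedD; [exact: adapted_mul|exact: adapted_cst].
apply: (adapted_noise noise_omega) => //.
by apply: adaptedD; [exact: adapted_mul|exact: adapted_cst].
Qed.

Lemma adapted_state u k : in_l2 K omega u -> (k <= K.+1)%N ->
  adapted omega k (state S omega x0 u k).
Proof.
move=> hu; elim: k => [|k IHk] kK; first exact: adapted_cst.
by apply: adapted_stateS => //; [exact/IHk/ltnW|exact: hu].
Qed.

Definition value u k : R :=
  Ex mu (fun t => qform (P k) (state S omega x0 u k t
                               - mean mu (state S omega x0 u k)))
  + qform (Q k) (mean mu (state S omega x0 u k)).

(** The excess cost of stage [k], measuring how far the control is from the feedback law, separately
    in its centred part and its mean. *)
Definition regret u k : R :=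
  Ex mu (fun t => qform (H1 S k (P k.+1))
    (u k t - mean mu (u k)
     + gain S k (P k.+1) *m (state S omega x0 u k t
                             - mean mu (state S omega x0 u k))))
  + qform (H1t S k (P k.+1) (Q k.+1))
      (mean mu (u k)
       + gaint S k (P k.+1) (Q k.+1) *m mean mu (state S omega x0 u k)).

Lemma regret_ge0 u k : (k <= K)%N -> 0 <= regret u k.
Proof.
move=> kK; have [_ _ _ _ /(_ k kK)[HP HQ]] := PQ.
rewrite addr_ge0//; last exact: posdef_qform_ge0.
by apply: Ex_ge0 => t; exact: posdef_qform_ge0.
Qed.

(** The next state is split into mean and fluctuation; the two completed squares, one in expectation
    and one for the means, then add up to the balance. *)
Lemma stage_cost u k : in_l2 K omega u -> (k <= K)%N ->
  'E_mu[fun t => sqnorm (output S omega x0 u k t)]%E =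
  (value u k - value u k.+1 + regret u k)%:E.
Proof.
move=> hu kK.
have hx := adapted_state hu (leqW kK).
have {}hu : adapted omega k (u k) by exact: hu.
(* Since [Psi1] has orthonormal columns, the control enters the cost with its plain norm. *)
have outE t : sqnorm (output S omega x0 u k t) =
    sqnorm (Phi1 S k *m state S omega x0 u k t) + sqnorm (u k t).
  rewrite sqnorm_col_mx; congr (_ + _).
  by rewrite sqnorm_mul Psi_orth// -sqnormE.
set x := state S omega x0 u k in hx outE *.
set w := u k in hu outE *.
set m := mean mu x; set b := mean mu w.
pose y t := x t - m; pose v t := w t - b.
have hx2 := adapted_L2vec hx; have hw2 := adapted_L2vec hu.
have hy : adapted omega k y by apply: adaptedD => //; exact: adapted_cst.
have hv : adapted omega k v by apply: adaptedD => //; exact: adapted_cst.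
have hy2 := adapted_L2vec hy; have hv2 := adapted_L2vec hv.
have y0 : mean mu y = 0 by exact: mean_sub_mean.
have v0 : mean mu v = 0 by exact: mean_sub_mean.
have xE t : x t = y t + m by rewrite subrK.
have wE t : w t = v t + b by rewrite subrK.
have L1q (j : nat) (M : 'M[R]_j) X : L2vec mu X ->
    (fun t => qform M (X t)) \in Lfun mu 1.
  by move=> hX; exact: bform_Lfun1.
have L1s (j : nat) (X : T -> 'cV[R]_j) : L2vec mu X ->
    (fun t => sqnorm (X t)) \in Lfun mu 1.
  by move=> hX; under eq_fun do rewrite sqnormE; exact: L1q.
have mS : mean mu (state S omega x0 u k.+1) = AA1 S k *m m + F1 S k *m b.
  rewrite /= -/x -/m.
  have hB : adapted omega k (fun t => B1 S k *m x t + B1t S k *m m).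
    by apply: adaptedD; [exact: adapted_mul|exact: adapted_cst].
  have hAx : L2vec mu (fun t => A1 S k *m x t) by exact: L2vec_mul.
  have hAm : L2vec mu (fun _ => A1t S k *m m) by exact: L2vec_cst.
  have hFw : L2vec mu (fun t => F1 S k *m w t) by exact: L2vec_mul.
  rewrite meanD; last 2 first.
  - by apply: L2vecD => //; exact: L2vecD.
  - exact: adapted_L2vec (adapted_noise noise_omega kK hB).
  rewrite (mean_noise noise_omega)// addr0 meanD//; last exact: L2vecD.
  by rewrite meanD// mean_cst !mean_mul// -mulmxDl.
(* Subtracting the means removes [A1t] from the drift, but the noise coefficient keeps the whole
   mean contribution [BB1 S k *m m]. *)
have yS t : state S omega x0 u k.+1 t - mean mu (state S omega x0 u k.+1) =
    (A1 S k *m y t + F1 S k *m v t)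
    + omega k t *: (B1 S k *m y t + BB1 S k *m m).
  rewrite mS /= -/x -/w -/m.
  have := wE t; have := xE t; move: (y t) (v t) => y' v' -> ->.
  rewrite !mulmxDr /AA1 /BB1 !mulmxDl [B1 S k *m y' + (_ + _)]addrA.
  move: (omega k t *: _) => z.
  by apply/matrixP => i j; rewrite !mxE; ring.
have hAF : adapted omega k (fun t => A1 S k *m y t + F1 S k *m v t).
  by apply: adaptedD; exact: adapted_mul.
have hBy : adapted omega k (fun t => B1 S k *m y t) by exact: adapted_mul.
(* The part [BB1 S k *m m] of the noise coefficient is what couples the equation for [Q] to [P]. *)
have EP : Ex mu (fun t => qform (P k.+1)
      (state S omega x0 u k.+1 t - mean mu (state S omega x0 u k.+1))) =
    Ex mu (fun t => qform (P k.+1) (A1 S k *m y t + F1 S k *m v t))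
    + (Ex mu (fun t => qform (P k.+1) (B1 S k *m y t))
       + qform (P k.+1) (BB1 S k *m m)).
  under eq_fun do rewrite yS.
  rewrite (Ex_qformD_noise noise_omega)//; last first.
    by apply: adaptedD => //; exact: adapted_cst.
  congr (_ + _); apply: Ex_qformD_cst; first exact: adapted_L2vec hBy.
  by rewrite mean_mul// y0 mulmx0.
have Es j l (C : 'M[R]_(j, l)) X c : L2vec mu X -> mean mu X = 0 ->
    Ex mu (fun t => sqnorm (C *m (X t + c))) =
    Ex mu (fun t => sqnorm (C *m X t)) + sqnorm (C *m c).
  move=> hX X0; rewrite sqnorm_mul.
  under eq_fun do rewrite sqnorm_mul.
  by rewrite Ex_qformD_cst//; under [in RHS]eq_fun do rewrite sqnorm_mul.
have [_ PE QE _ /(_ k kK)[HP HQ]] := PQ.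
have [PT QT] := riccati_solution_sym PQ (kK : (k.+1 <= K.+1)%N).
have Phiy : L2vec mu (fun t => Phi1 S k *m y t) by exact: L2vec_mul.
have sqP : Ex mu (fun t => qform (P k.+1) (A1 S k *m y t + F1 S k *m v t))
    + Ex mu (fun t => qform (P k.+1) (B1 S k *m y t))
    + Ex mu (fun t => sqnorm (Phi1 S k *m y t)) + Ex mu (fun t => sqnorm (v t)) =
    Ex mu (fun t => qform (P k) (y t))
    + Ex mu (fun t => qform (H1 S k (P k.+1)) (v t + gain S k (P k.+1) *m y t)).
  have q1 := L1q _ (P k.+1) _ (adapted_L2vec hAF).
  have q2 := L1q _ (P k.+1) _ (adapted_L2vec hBy).
  have q3 := L1s _ _ Phiy; have q4 := L1s _ _ hv2.
  rewrite -!ExD//; last 4 first.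
  - exact: L1q.
  - by apply: L1q; apply: L2vecD; [exact: hv2|exact: L2vec_mul].
  - by apply: LfunD => //; exact: LfunD.
  - exact: LfunD.
  by congr Ex; apply/funext => t; rewrite riccati_square// -PE.
have sqQ := riccatit_square m b QT HQ.
rewrite -QE// in sqQ.
under eq_fun do rewrite outE.
rewrite ExK; last by apply: LfunD => //; apply: L1s => //; exact: L2vec_mul.
congr EFin; rewrite ExD//; [|by apply: L1s; exact: L2vec_mul|exact: L1s].
have -> : Ex mu (fun t => sqnorm (Phi1 S k *m x t)) =
    Ex mu (fun t => sqnorm (Phi1 S k *m y t)) + sqnorm (Phi1 S k *m m).
  by rewrite -Es//; under eq_fun do rewrite xE.
have -> : Ex mu (fun t => sqnorm (w t)) =
    Ex mu (fun t => sqnorm (v t)) + sqnorm b.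
  have := Es _ _ 1%:M v b hv2 v0; rewrite !mul1mx.
  under eq_fun do rewrite mul1mx -wE.
  by under [in RHS]eq_fun do rewrite mul1mx.
(* The remaining identity is the sum of [sqP] and [sqQ]; the [BB1] term of [EP] matches that of
   [sqQ]. *)
rewrite /value /regret EP mS -/x -/w -/m -/b -/(y _) -/(v _).
lra.
Qed.

(** The initial state is deterministic, hence equal to its mean and without fluctuation. *)
Lemma value_first u : value u 0 = qform (Q 0%N) x0.
Proof.
rewrite /value /= mean_cst subrr.
by under eq_fun do rewrite qform_vec0; rewrite Ex_cst add0r.
Qed.

Lemma value_last u : value u K.+1 = 0.
Proof.
have [_ _ _ [PK QK] _] := PQ; rewrite /value PK QK qform0 addr0.
by under eq_fun do rewrite qform0; rewrite Ex_cst.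
Qed.

Lemma costE u : in_l2 K omega u ->
  cost S omega x0 K u =
  (qform (Q 0%N) x0 + \sum_(k < K.+1) regret u k)%:E.
Proof.
move=> hu; rewrite /cost.
rewrite (eq_bigr (fun k : 'I_K.+1 =>
    (value u k - value u k.+1 + regret u k)%:E)); last first.
  by move=> k _; apply: stage_cost => //; rewrite -ltnS.
rewrite sumEFin big_split /=; congr (_ + _)%:E.
under eq_bigr do rewrite -opprB.
rewrite sumrN -(big_mkord predT (fun k => value u k.+1 - value u k)).
by rewrite telescope_sumr// opprB value_first value_last subr0.
Qed.

(** * The feedback law in closed loop *)

Lemma feedbackE k (x m : 'cV[R]_n) : feedback S P Q k x m =
  - gain S k (P k.+1) *m (x - m) - gaint S k (P k.+1) (Q k.+1) *m m.
Proof.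
rewrite /feedback -/(gain _ _ _) -/(gaint _ _ _ _) mulNmx mulmxBr mulmxBl.
by rewrite opprB addrCA addrA.
Qed.

(** The control depends on the present state and the state on earlier controls; eliminating the
    control leaves a recursion on time alone. *)
Fixpoint closed_loop k : T -> 'cV[R]_n :=
  if k is j.+1 then fun t =>
    A1 S j *m closed_loop j t + A1t S j *m mean mu (closed_loop j)
    + F1 S j *m feedback S P Q j (closed_loop j t) (mean mu (closed_loop j))
    + omega j t *:
      (B1 S j *m closed_loop j t + B1t S j *m mean mu (closed_loop j))
  else fun=> x0.

Definition optimal_control k t : 'cV[R]_q :=
  feedback S P Q k (closed_loop k t) (mean mu (closed_loop k)).

Lemma state_optimal k : state S omega x0 optimal_control k = closed_loop k.
Proof. by elim: k => //= k ->. Qed.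

Lemma adapted_feedback k X :
  adapted omega k X ->
  adapted omega k (fun t => feedback S P Q k (X t) (mean mu X)).
Proof.
move=> hX; under eq_fun do rewrite feedbackE.
apply: adaptedD; last exact: adapted_cst.
by apply: adapted_mul; apply: adaptedD => //; exact: adapted_cst.
Qed.

Lemma adapted_closed_loop k : (k <= K.+1)%N -> adapted omega k (closed_loop k).
Proof.
elim: k => [|k IHk] kK; first exact: adapted_cst.
have {}IHk := IHk (ltnW kK).
rewrite -state_optimal; apply: adapted_stateS => //.
  by rewrite state_optimal.
exact: adapted_feedback.
Qed.

Lemma in_l2_optimal : in_l2 K omega optimal_control.
Proof.
by move=> k kK; apply: adapted_feedback; exact/adapted_closed_loop/ltnW.
Qed.

(** The centred state has zero mean, so the mean of the feedback is minus [gaint] times the mean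
    state, and both quadratic forms in [regret] are taken at 0. *)
Lemma regret_optimal k : (k <= K)%N -> regret optimal_control k = 0.
Proof.
move=> kK; have /adapted_L2vec hx := adapted_closed_loop (leqW kK).
rewrite /regret state_optimal.
set x := closed_loop k in hx *; set m := mean mu x.
have hy : L2vec mu (fun t => x t - m) by exact: sub_mean_L2vec.
have uE t : optimal_control k t =
    - gain S k (P k.+1) *m (x t - m) + - gaint S k (P k.+1) (Q k.+1) *m m.
  by rewrite mulNmx [in RHS]mulNmx; rewrite /optimal_control feedbackE mulNmx.
have -> : mean mu (optimal_control k) = - gaint S k (P k.+1) (Q k.+1) *m m.
  rewrite (_ : optimal_control k = fun t => - gain S k (P k.+1) *m (x t - m) +
    - gaint S k (P k.+1) (Q k.+1) *m m); last exact/funext.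
  rewrite meanD ?mean_cst; [|exact: L2vec_mul|exact: L2vec_cst].
  by rewrite mean_mul// mean_sub_mean// mulmx0 add0r.
under eq_fun do rewrite uE addrK mulNmx addNr qform_vec0.
by rewrite Ex_cst mulNmx addNr qform_vec0 addr0.
Qed.

Lemma cost_optimal :
  cost S omega x0 K optimal_control = (qform (Q 0%N) x0)%:E.
Proof.
rewrite costE; last exact: in_l2_optimal.
by rewrite big1 ?addr0// => k _; rewrite regret_optimal// -ltnS.
Qed.

Lemma optimal_control_min v : in_l2 K omega v ->
  (cost S omega x0 K optimal_control <= cost S omega x0 K v)%E.
Proof.
move=> hv; rewrite cost_optimal costE// lee_fin lerDl.
by apply: sumr_ge0 => k _; apply: regret_ge0; rewrite -ltnS.
Qed.

End Cost.

Theorem theorem3p1 (R : realType) (d : measure_display) (T : measurableType d)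
    (mu : probability T R) (n q K : nat) (S : mf_system R n q)
    (omega : nat -> {RV mu >-> R}) (x0 : 'cV[R]_n) (P Q : nat -> 'M[R]_n) :
  measure_is_complete mu ->
  noise K omega ->
  (forall k, (k <= K)%N -> (Psi1 S k)^T *m Psi1 S k = 1%:M) ->
  riccati_unique_solution S K P Q ->
  (exists u : nat -> T -> 'cV[R]_q,
    [/\ in_l2 K omega u,
        forall k, (k <= K)%N -> forall t,
          u k t = feedback S P Q k (state S omega x0 u k t)
                    (mean mu (state S omega x0 u k)),
        forall v : nat -> T -> 'cV[R]_q, in_l2 K omega v ->
          (cost S omega x0 K u <= cost S omega x0 K v)%E,
        cost S omega x0 K u = (qform (Q 0%N) (mean mu (fun=> x0)))%:E
      & 0 <= qform (Q 0%N) (mean mu (fun=> x0))]) /\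
  (forall k, (k <= K)%N -> possemidef (Q k)).
Proof.
move=> _ noise_omega Psi_orth [PQ _].
split=> [|k kK]; last exact: (riccati_possemidef PQ (leqW kK)).2.
exists (optimal_control S omega x0 P Q); split.
- exact: in_l2_optimal.
- by move=> k _ t; rewrite state_optimal.
- by move=> v; exact: optimal_control_min.
- by rewrite mean_cst cost_optimal.
- exact: (riccati_possemidef PQ (leq0n K.+1)).2.2.
Qed.
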